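(* Let $R$ be an integral domain and let $A\in M_n(R)$ have monic invariant factors $1\ne f_1|\cdots|f_m$ in $R[X]$, meaning that $A$ is similar (over $R$) to $C_{f_1}\oplus\cdots\oplus C_{f_m}$ or, equivalently, that the column space $R^n$, viewed as an $R[X]$-module via $A$, decomposes as the direct sum of cyclic submodules with annihilating ideals $R[X]f_1,\dots,R[X]f_m$. Make $M_n(R)$ into an $R[X]$-module via $A$ by declaring $p(X)B=p(A)B$ for $p(X)\in R[X]$ and $B\in M_n(R)$. Then $M_n(R)$ has invariant factors $f_1,\dots,f_1,f_2,\dots,f_2,\dots,f_m,\dots,f_m$, where each $f_i$ is repeated $n$ times.
   Context: For monic $f=f_0+f_1X+\cdots+f_{k-1}X^{k-1}+X^k\in R[X]$ the companion matrix $C_f\in M_k(R)$ has $1$'s on the first subdiagonal, last column $(-f_0,\dots,-f_{k-1})^T$, and $0$'s elsewhere. An $R[X]$-module has (monic) invariant factors $h_1|\cdots|h_t$ if it is the direct sum of cyclic submodules with annihilating ideals $R[X]h_1,\dots,R[X]h_t$. *)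

(* Defs.v *)
From HB Require Import structures.
From mathcomp Require Import all_boot all_order all_algebra.

Set Implicit Arguments.
Unset Strict Implicit.
Unset Printing Implicit Defensive.

Import GRing.Theory.
Local Open Scope ring_scope.

(* The matrices with k columns as an R[X]-module via A : k = 1 gives the column
   space, and k = n.+1 gives the square matrices.  The alias is needed since
   'M[R]_(n.+1, k) already carries a canonical module structure over R. *)
Definition mx_module (R : comNzRingType) (n : nat) (A : 'M[R]_n.+1) (k : nat) :
  Type := 'M[R]_(n.+1, k).

Section MxModule.
Variables (R : comNzRingType) (n : nat) (A : 'M[R]_n.+1) (k : nat).

HB.instance Definition _ :=
  GRing.Zmodule.copy (mx_module A k) 'M[R]_(n.+1, k).

Definition mx_module_scale (p : {poly R}) (B : mx_module A k) : mx_module A k :=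
  horner_mx A p *m (B : 'M[R]_(n.+1, k)).

Fact mx_module_scaleA p q B :
  mx_module_scale p (mx_module_scale q B) = mx_module_scale (p * q) B.
Proof. by rewrite /mx_module_scale mulmxA rmorphM. Qed.

Fact mx_module_scale1 : left_id 1 mx_module_scale.
Proof. by move=> B; rewrite /mx_module_scale rmorph1 mul1mx. Qed.

Fact mx_module_scaleDr : right_distributive mx_module_scale +%R.
Proof. by move=> p B C; rewrite /mx_module_scale; exact: mulmxDr. Qed.

Fact mx_module_scaleDl B :
  {morph mx_module_scale^~ B : p q / p + q}.
Proof. by move=> p q; rewrite /mx_module_scale rmorphD; exact: mulmxDl. Qed.

HB.instance Definition _ :=
  GRing.Zmodule_isLmodule.Build {poly R} (mx_module A k)
    mx_module_scaleA mx_module_scale1 mx_module_scaleDr mx_module_scaleDl.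

Lemma mx_module_scaleE (p : {poly R}) (B : mx_module A k) :
  p *: B = horner_mx A p *m (B : 'M[R]_(n.+1, k)).
Proof. by []. Qed.
End MxModule.

(* Divisibility in the ring S.  The library's %| on {poly R} is defined by
   pseudo-division, so it is only divisibility up to a nonzero scalar. *)
Definition divides (S : comNzRingType) (a b : S) : Prop := exists c, b = c * a.

Definition monic_chain (R : comNzRingType) (hs : seq {poly R}) : Prop :=
  (forall i, (i < size hs)%N -> hs`_i \is monic) /\
  (forall i, (i.+1 < size hs)%N -> divides (hs`_i) (hs`_i.+1)).

Section Modules.
Variables (S : comNzRingType) (V : lmodType S).

Definition is_cyclic_submodule (W : V -> Prop) : Prop :=
  exists v : V, forall w : V, W w <-> exists p : S, w = p *: v.

Definition annihilator (W : V -> Prop) (p : S) : Prop :=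
  forall w : V, W w -> p *: w = 0.

Definition is_internal_direct_sum (t : nat) (W : 'I_t -> V -> Prop) : Prop :=
  forall v : V, exists! u : {ffun 'I_t -> V},
    (forall i, W i (u i)) /\ v = \sum_(i < t) u i.
End Modules.

Definition module_has_invariant_factors (R : comNzRingType)
    (V : lmodType {poly R}) (hs : seq {poly R}) : Prop :=
  monic_chain hs /\
  exists W : 'I_(size hs) -> V -> Prop,
    [/\ forall i, is_cyclic_submodule (W i),
        forall i p, annihilator (W i) p <-> divides (hs`_i) p
      & is_internal_direct_sum W].

(* The library's companionmx has its 1's above the diagonal and the negated
   coefficients in its last row. *)
Definition companion (R : comNzRingType) (f : {poly R}) :
  'M[R]_((size f).-1) := (companionmx f)^T.

Definition companion_sum (R : comNzRingType) (fs : seq {poly R}) :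
  'M[R]_((\sum_(i < size fs) (size (fs`_i)%R).-1)%N) :=
  \mxdiag_(i < size fs) companion (fs`_i).

Definition is_similar (R : comUnitRingType) (n : nat) (A B : 'M[R]_n) : Prop :=
  exists2 P : 'M[R]_n, P \in unitmx & A = P *m B *m invmx P.

Definition mx_has_invariant_factors (R : idomainType) (n : nat)
    (A : 'M[R]_n) (fs : seq {poly R}) : Prop :=
  monic_chain fs /\
  exists e : (\sum_(i < size fs) (size (fs`_i)%R).-1)%N = n,
    is_similar A (castmx (e, e) (companion_sum fs)).

(* Main.v *)
Require Import Defs.
From HB Require Import structures.
From mathcomp Require Import all_boot all_order all_algebra.
Import GRing.Theory.
Local Open Scope ring_scope.

(** Everything rests on a description by generators.  A module V over a ring S
    is an internal direct sum of cyclic submodules with annihilators S h_i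
    exactly when there are vectors v_i that span V and whose relations
    sum_i p_i v_i = 0 are exactly those with h_i | p_i for all i
    ([direct_sum_cyclicP]).

    With this description the statement on matrices follows from the one on
    columns.  As an R[X]-module, the n x k matrices are k copies of the column
    space, one for each column: if the v_i generate the column space in the
    above sense, then the matrices with v_i in column j and 0 elsewhere generate
    the matrices, and the relations can be read off column by column
    ([cyclic_decomposition_mx]).  It only remains to renumber the pairs (i, j)
    as i * k + j.

    For the column space, let d_i be the degree of f_i, and let K_i be the
    Krylov matrix with columns v_i, A v_i, ..., A^(d_i - 1) v_i.  For monic f_i,
    the equation A K_i = K_i C_(f_i) holds when f_i(A) v_i = 0, and every
    solution of A B = B C_(f_i) is the Krylov matrix of such a vector
    ([mul_krylov_companion], [krylov_of_companion]).  Hence the similarities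
    between A and the direct sum of the C_(f_i) are given by the invertible
    block rows Q = (K_1 ... K_t) with f_i(A) v_i = 0.  Since Q sends the
    coefficients of polynomials r_i of degree less than d_i to
    sum_i r_i(A) v_i, division with remainder by the f_i shows that Q is
    bijective exactly when the v_i generate the column space with annihilators
    R[X] f_i.  A matrix with a two-sided inverse over a nonzero commutative ring
    is square, which gives sum_i d_i = n. *)

Set Implicit Arguments.
Unset Strict Implicit.
Unset Printing Implicit Defensive.

(** * Direct sums of cyclic modules by generators and relations *)

Section CyclicDecomposition.
Variables (S : comNzRingType) (V : lmodType S).

(** The vectors [v i] span [V], and their relations are generated by
    [h i *: v i = 0].  Equivalently, [V] is the direct sum of the submodules
    spanned by each [v i], and the annihilator of [v i] is the ideal generated
    by [h i].  The index type is an arbitrary finite type, so that pairs can be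
    used as indices. *)
Definition cyclic_decomposition (I : finType) (h : I -> S) (v : I -> V) :
    Prop :=
  (forall x, exists p : I -> S, x = \sum_i p i *: v i) /\
  (forall p : I -> S,
     \sum_i p i *: v i = 0 <-> forall i, divides (h i) (p i)).

Lemma dividesxx (a : S) : divides a a.
Proof. by exists 1; rewrite mul1r. Qed.

Lemma divides0 (a : S) : divides a 0.
Proof. by exists 0; rewrite mul0r. Qed.

Lemma cyclic_decomposition_ann (I : finType) (h : I -> S) (v : I -> V) :
  cyclic_decomposition h v -> forall i p, p *: v i = 0 <-> divides (h i) p.
Proof.
move=> [_ rel] i p; pose q j := if j == i then p else 0.
have <- : \sum_j q j *: v j = p *: v i.
  rewrite (bigD1 i) //= /q eqxx big1 ?addr0 // => j /negPf ->.
  by rewrite scale0r.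
apply: (iff_trans (rel q)); split=> [/(_ i)|hp j]; rewrite /q ?eqxx //.
by case: eqP => [->|_] //; exact: divides0.
Qed.

Lemma direct_sum_cyclicP (t : nat) (h : 'I_t -> S) :
  (exists W : 'I_t -> V -> Prop,
     [/\ forall i, is_cyclic_submodule (W i),
         forall i p, annihilator (W i) p <-> divides (h i) p
       & is_internal_direct_sum W]) <->
  exists v, cyclic_decomposition h v.
Proof.
split=> [[W [/fin_all_exists[v Wv] Wh Wsum]]|[v hv]].
  exists v; split=> [x|p].
    have [u [[Wu ->] _]] := Wsum x.
    have /fin_all_exists[p up] i : exists p, u i = p *: v i by apply/Wv.
    by exists p; apply: eq_bigr => i _.
  have annE i q : divides (h i) q <-> q *: v i = 0.
    apply: (iff_trans (iff_sym (Wh i q))); split=> [|qv w /Wv[r ->]].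
      by apply; apply/Wv; exists 1; rewrite scale1r.
    by rewrite scalerA mulrC -scalerA qv scaler0.
  split=> [pv0 i|hp]; last by apply: big1 => i _; apply/annE.
  have [u0 [_ u0P]] := Wsum 0; apply/annE.
  (* [0] has the two decompositions [p i *: v i] and [0]. *)
  have u0E : u0 = [ffun i => p i *: v i].
    apply: u0P; split=> [j|]; first by apply/Wv; exists (p j); rewrite ffunE.
    by rewrite -[LHS]pv0; apply: eq_bigr => j _; rewrite ffunE.
  have u0E' : u0 = [ffun=> 0].
    apply: u0P; split=> [j|].
      by apply/Wv; exists 0; rewrite ffunE scale0r.
    by rewrite big1 // => j _; rewrite ffunE.
  by have /ffunP/(_ i) := etrans (esym u0E) u0E'; rewrite !ffunE.
have ann := cyclic_decomposition_ann hv; have [span rel] := hv.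
exists (fun i w => exists p, w = p *: v i); split=> [i|i p|x].
- by exists (v i).
- apply: iff_trans (ann i p); split=> [|pv w [r ->]].
    by apply; exists 1; rewrite scale1r.
  by rewrite scalerA mulrC -scalerA pv scaler0.
have [p ->] := span x; exists [ffun i => p i *: v i]; split.
  split=> [i|]; first by exists (p i); rewrite ffunE.
  by apply: eq_bigr => i _; rewrite ffunE.
move=> u [/fin_all_exists[q uE] pq]; apply/ffunP => i; rewrite ffunE uE.
apply/eqP; rewrite -subr_eq0 -scalerBl; apply/eqP/ann; move: i.
apply/(rel (fun i => p i - q i)).
under eq_bigr do rewrite scalerBl -uE.
by rewrite sumrB pq subrr.
Qed.

Lemma cyclic_decomposition_reindex (I J : finType) (g : J -> I)
    (h : I -> S) (v : I -> V) :
  bijective g -> cyclic_decomposition h v ->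
  cyclic_decomposition (h \o g) (v \o g).
Proof.
move=> bij_g [span rel]; have [g' gK g'K] := bij_g.
have sumE (p : J -> S) : \sum_j p j *: v (g j) = \sum_i p (g' i) *: v i.
  rewrite [RHS](reindex g) /=; last exact: onW_bij.
  by under [RHS]eq_bigr do rewrite gK.
split=> [x|p].
  have [p ->] := span x; exists (p \o g); rewrite sumE.
  by apply: eq_bigr => i _; rewrite /= g'K.
rewrite sumE; apply: (iff_trans (rel (p \o g'))); split=> hp i.
  by have := hp (g i); rewrite /= gK.
by have := hp (g' i); rewrite /= g'K.
Qed.

End CyclicDecomposition.

(** * Repeating the entries of a sequence *)

Section Repeat.
Variables (T : Type) (k : nat).

Lemma size_flatten_nseq (s : seq T) :
  size (flatten [seq nseq k x | x <- s]) = (size s * k)%N.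
Proof. by elim: s => //= x s IHs; rewrite size_cat size_nseq IHs mulSn. Qed.

Lemma nth_flatten_nseq (x0 : T) (s : seq T) (i : nat) : (0 < k)%N ->
  nth x0 (flatten [seq nseq k x | x <- s]) i = nth x0 s (i %/ k).
Proof.
move=> k_gt0; elim: s i => [|x s IHs] i /=; first by rewrite !nth_nil.
rewrite nth_cat size_nseq; case: ltnP => [i_lt|i_ge].
  by rewrite divn_small //= nth_nseq i_lt.
by rewrite IHs -{2}(subnK i_ge) divnDr ?dvdnn // divnn k_gt0 addn1.
Qed.

End Repeat.

Lemma monic_chain_flatten_nseq (R : comNzRingType) (k : nat)
    (fs : seq {poly R}) : (0 < k)%N ->
  monic_chain fs -> monic_chain (flatten [seq nseq k f | f <- fs]).
Proof.
move=> k_gt0 [mon div]; split=> i;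
  rewrite size_flatten_nseq !nth_flatten_nseq //.
  by move=> i_lt; apply: mon; rewrite ltn_divLR.
rewrite -ltn_divLR // divnS //; case: dvdnP => _; first exact: div.
by move=> _; exact: dividesxx.
Qed.

(** The bijection sends [i] to [(i %/ k, i %% k)]. *)
Lemma flatten_nseq_index (R : comNzRingType) (k : nat) (fs : seq {poly R}) :
  (0 < k)%N ->
  exists2 g : 'I_(size (flatten [seq nseq k f | f <- fs])) ->
              'I_(size fs) * 'I_k,
    bijective g &
    forall i : 'I_(size (flatten [seq nseq k f | f <- fs])),
      (flatten [seq nseq k f | f <- fs])`_i = fs`_((g i).1).
Proof.
move=> k_gt0.
have div_lt (i : 'I_(size (flatten [seq nseq k f | f <- fs]))) :
    (i %/ k < size fs)%N by rewrite ltn_divLR // -size_flatten_nseq.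
exists (fun i => (Ordinal (div_lt i), Ordinal (ltn_pmod i k_gt0))).
  apply: inj_card_bij; last by rewrite card_prod !card_ord size_flatten_nseq.
  move=> i j [eq_div eq_mod]; apply: val_inj.
  by rewrite /= (divn_eq i k) (divn_eq j k) eq_div eq_mod.
by move=> i; rewrite nth_flatten_nseq.
Qed.

(** * Matrices as copies of the column space *)

Section Columns.
Variables (R : comNzRingType) (n k : nat) (A : 'M[R]_n.+1).

Definition mx_module_col (j : 'I_k) (x : mx_module A k) : mx_module A 1 :=
  col j x.

(** The matrix with column [j] equal to [v] and all other columns 0. *)
Definition mx_module_in (v : mx_module A 1) (j : 'I_k) : mx_module A k :=
  (v : 'cV_n.+1) *m delta_mx 0 j.

Lemma mx_module_colP (x y : mx_module A k) :
  (forall j, mx_module_col j x = mx_module_col j y) -> x = y.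
Proof.
move=> eq_xy; apply/matrixP => r j; have /colP/(_ r) := eq_xy j.
by rewrite !mxE.
Qed.

Lemma mx_module_col_in v j j' :
  mx_module_col j (mx_module_in v j') = if j' == j then v else 0.
Proof.
rewrite /mx_module_col /mx_module_in colE -mulmxA mul_delta_mx_cond.
case: eqP => _; last by rewrite mulr0n mulmx0.
rewrite mulr1n -[RHS]mulmx1; congr (_ *m _).
by apply/matrixP => a b; rewrite !ord1 !mxE.
Qed.

Lemma mx_module_colZ p j x :
  mx_module_col j (p *: x) = p *: mx_module_col j x.
Proof. by rewrite !mx_module_scaleE /mx_module_col !colE mulmxA. Qed.

Lemma mx_module_col_sum (I : finType) (F : I -> mx_module A k) j :
  mx_module_col j (\sum_i F i) = \sum_i mx_module_col j (F i).
Proof. exact: (raddf_sum (col j)). Qed.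

(** Column [j] of a combination of the [mx_module_in (v i) j] is the combination
    of the [v i] with the coefficients [p (i, j)], so that both spanning and
    relations can be checked on each column. *)
Lemma cyclic_decomposition_mx (I : finType) (h : I -> {poly R})
    (v : I -> mx_module A 1) :
  cyclic_decomposition h v ->
  cyclic_decomposition (fun ij : I * 'I_k => h ij.1)
    (fun ij => mx_module_in (v ij.1) ij.2).
Proof.
move=> [span rel].
have col_sum (p : I * 'I_k -> {poly R}) (j : 'I_k) :
    mx_module_col j (\sum_ij p ij *: mx_module_in (v ij.1) ij.2)
    = \sum_i p (i, j) *: v i.
  rewrite mx_module_col_sum.
  under eq_bigr do rewrite mx_module_colZ mx_module_col_in.
  rewrite (eq_bigr (fun ij => p (ij.1, ij.2) *:
                      if ij.2 == j then v ij.1 else 0)); last by case.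
  rewrite -(pair_bigA _ (fun i j' => p (i, j') *:
                           if j' == j then v i else 0)) /=.
  apply: eq_bigr => i _; rewrite (bigD1 j) //= eqxx big1 ?addr0 // => j'.
  by move=> /negPf->; rewrite scaler0.
split=> [x|p].
  have /fin_all_exists[p xE] (j : 'I_k) := span (mx_module_col j x).
  exists (fun ij => p ij.2 ij.1); apply: mx_module_colP => j.
  by rewrite col_sum xE.
split=> [p0 [i j]|hp].
  have /rel/(_ i) : \sum_i p (i, j) *: v i = 0; last by [].
  by rewrite -col_sum p0; apply/colP => r; rewrite !mxE.
apply: mx_module_colP => j; rewrite col_sum.
transitivity (0 : mx_module A 1); last by apply/colP => r; rewrite !mxE.
by apply/(rel (fun i => p (i, j))) => i; exact: (hp (i, j)).
Qed.

Lemma cyclic_decomposition_nseq (fs : seq {poly R})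
    (v : 'I_(size fs) -> mx_module A 1) : (0 < k)%N ->
  cyclic_decomposition (fun i : 'I_(size fs) => fs`_i) v ->
  let hs := flatten [seq nseq k f | f <- fs] in
  exists w : 'I_(size hs) -> mx_module A k,
    cyclic_decomposition (fun i : 'I_(size hs) => hs`_i) w.
Proof.
move=> k_gt0 /cyclic_decomposition_mx dec_v hs.
have [g bij_g gE] := flatten_nseq_index fs k_gt0.
have [span rel] := cyclic_decomposition_reindex bij_g dec_v.
exists (fun i => mx_module_in (v (g i).1) (g i).2).
split=> [x|p]; first exact: span x.
apply: (iff_trans (rel p)).
by split=> hp i; have := hp i; rewrite /= gE.
Qed.

End Columns.

(** * Krylov matrices and companion matrices *)

Section Krylov.
Variables (R : comNzRingType) (n : nat) (A : 'M[R]_n.+1).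

(** The matrix with columns [v], [A *m v], ..., [A ^+ d.-1 *m v]. *)
Definition krylov (v : 'cV[R]_n.+1) (d : nat) : 'M[R]_(n.+1, d) :=
  \matrix_(r, j) (A ^+ j *m v) r 0.

Lemma col_krylov v d (j : 'I_d) : col j (krylov v d) = A ^+ j *m v.
Proof. by apply/colP => r; rewrite !mxE. Qed.

Lemma mul_krylov v d (y : 'cV[R]_d) :
  krylov v d *m y = horner_mx A (rVpoly y^T) *m v.
Proof.
rewrite /rVpoly poly_def raddf_sum mulmx_suml; apply/colP => r.
rewrite !mxE summxE; apply: eq_bigr => j _.
rewrite valK /= horner_mxZ rmorphXn /= horner_mx_X -scalemxAl !mxE.
by rewrite mulrC.
Qed.

(** Column [j] of the companion matrix of [f] contains the coefficients of the
    remainder of ['X^(j.+1)] modulo [f]. *)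
Lemma rVpoly_row_companion (f : {poly R}) (j : 'I_(size f).-1) :
  f \is monic ->
  rVpoly (row j (companionmx f)) =
    'X^(j.+1) - (if j.+1 == (size f).-1 then f else 0).
Proof.
move=> f_mon; apply/polyP => i.
have f_size : size f = (size f).-1.+1.
  by rewrite prednK // size_poly_gt0 monic_neq0.
have j_last : (j == (size f).-1.-1 :> nat) = (j.+1 == (size f).-1).
  by rewrite -(eqn_add2r 1) !addn1 prednK // (leq_ltn_trans _ (ltn_ord j)).
rewrite coef_rVpoly coefB coefXn.
case: insubP => [i' i_lt i'E|]; last rewrite -leqNgt => i_ge.
  rewrite !mxE j_last i'E; case: (j.+1 =P _) => [jE|_].
    by rewrite jE (ltn_eqF i_lt) sub0r.
  by rewrite coef0 subr0 eq_sym.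
case: (j.+1 =P _) => [jE|/eqP j_neq]; last first.
  rewrite coef0 subr0; case: eqP => // iE; case/negP: j_neq.
  by rewrite eqn_leq ltn_ord -iE i_ge.
rewrite jE; case: eqP => [->|/eqP i_neq].
  by have /eqP := monicP f_mon; rewrite /lead_coef => /eqP ->; rewrite subrr.
by rewrite sub0r nth_default ?oppr0 // f_size ltn_neqAle eq_sym i_neq.
Qed.

Lemma col_mul_companion (f : {poly R}) m (B : 'M[R]_(m, (size f).-1)) j :
  col j (B *m companion f) = B *m (row j (companionmx f))^T.
Proof. by rewrite tr_row /companion !colE mulmxA. Qed.

(** The converse needs a positive degree: if [f = 1], the Krylov matrix has no
    columns and says nothing about [v]. *)
Lemma mul_krylov_companion (f : {poly R}) v : f \is monic ->
  (horner_mx A f *m v = 0 ->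
     A *m krylov v (size f).-1 = krylov v (size f).-1 *m companion f) /\
  ((0 < (size f).-1)%N ->
     A *m krylov v (size f).-1 = krylov v (size f).-1 *m companion f ->
     horner_mx A f *m v = 0).
Proof.
move=> f_mon; set K := krylov _ _.
have colA j : col j (A *m K) = A ^+ j.+1 *m v.
  by rewrite colE -mulmxA -colE col_krylov exprS mulmxA.
have colC j : col j (K *m companion f) =
    A ^+ j.+1 *m v - (if j.+1 == (size f).-1 then horner_mx A f *m v else 0).
  rewrite col_mul_companion mul_krylov trmxK rVpoly_row_companion //.
  rewrite rmorphB rmorphXn /= horner_mx_X mulmxBl; congr (_ - _).
  by case: ifP; rewrite ?rmorph0 ?mul0mx.
split=> [fv|d_gt0 AK].
  apply/matrixP=> r j.
  have /colP/(_ r) : col j (A *m K) = col j (K *m companion f).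
    by rewrite colA colC fv if_same subr0.
  by rewrite mxE => ->; rewrite mxE.
(* Compare the last columns. *)
have lt_d : ((size f).-1.-1 < (size f).-1)%N by rewrite ltn_predL.
have := colC (Ordinal lt_d).
rewrite -AK colA /= prednK // eqxx => /eqP.
by rewrite -subr_eq0 opprB addrC subrK => /eqP.
Qed.

(** [v] is the first column of [B], or [0] if [B] has no columns. *)
Lemma krylov_of_companion (f : {poly R}) (B : 'M[R]_(n.+1, (size f).-1)) :
  f \is monic -> A *m B = B *m companion f ->
  exists2 v, horner_mx A f *m v = 0 & B = krylov v (size f).-1.
Proof.
move=> f_mon AB; have [|d_gt0] := leqP (size f).-1 0.
  rewrite leqn0 => /eqP d0; exists 0; first by rewrite mulmx0.
  by apply/matrixP => r [j j_lt]; exfalso; rewrite d0 in j_lt.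
pose v := col (Ordinal d_gt0) B.
have BE : B = krylov v (size f).-1.
  suff colB i (i_lt : (i < (size f).-1)%N) :
      col (Ordinal i_lt) B = A ^+ i *m v.
    apply/matrixP => r [i i_lt]; have /colP/(_ r) := colB i i_lt.
    by rewrite !mxE.
  elim: i i_lt => [|i IHi] i_lt.
    by rewrite expr0 mul1mx /v; congr (col _ B); apply: val_inj.
  rewrite exprS -mulmxE -mulmxA -(IHi (ltnW i_lt)).
  rewrite [in RHS]colE mulmxA AB -colE col_mul_companion colE; congr (_ *m _).
  apply/colP => j; rewrite !mxE !eqxx andbT /= ltn_eqF; last first.
    by rewrite -ltnS prednK.
  by rewrite eq_sym.
exists v => //.
by apply: (proj2 (mul_krylov_companion v f_mon)); rewrite -?BE.
Qed.

End Krylov.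

(** * Similarity to a sum of companion matrices *)

(** The matrices [Q] and [Q'] are not of a syntactically square type, which
    avoids the cast. *)
Lemma is_similar_castP (R : comUnitRingType) (N n : nat) (e : N = n)
    (A : 'M[R]_n) (C : 'M[R]_N) :
  is_similar A (castmx (e, e) C) <->
  exists (Q : 'M_(n, N)) (Q' : 'M_(N, n)),
    [/\ Q *m Q' = 1%:M, Q' *m Q = 1%:M & A *m Q = Q *m C].
Proof.
case: n / e A => A; rewrite castmx_id; split=> [[P P_unit ->]|].
  exists P, (invmx P); split; rewrite ?mulmxV ?mulVmx //.
  by rewrite -mulmxA mulVmx // mulmx1.
move=> [Q [Q' [QQ' Q'Q AQ]]]; have [Q_unit _] := mulmx1_unit QQ'.
by exists Q => //; rewrite -AQ -mulmxA mulmxV // mulmx1.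
Qed.

(** Monicity makes this hold over any commutative ring. *)
Lemma divides_size_lt (R : comNzRingType) (f p : {poly R}) :
  f \is monic -> (size p < size f)%N -> divides f p -> p = 0.
Proof.
move=> f_mon p_lt [q pE]; apply/eqP; apply: contraLR p_lt => p_neq0.
have q_neq0 : q != 0 by apply: contra_neq p_neq0 => q0; rewrite pE q0 mul0r.
have f_gt0 : (0 < size f)%N by rewrite size_poly_gt0 monic_neq0.
have q_gt0 : (0 < size q)%N by rewrite size_poly_gt0.
rewrite -leqNgt pE size_Mmonic //.
by case: (size q) q_gt0 => // s _; rewrite addSn leq_addl.
Qed.

Section KrylovRow.
Variables (R : comNzRingType) (n : nat) (A : 'M[R]_n.+1) (t : nat).
Variables (f : 'I_t -> {poly R}) (f_mon : forall i, f i \is monic).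
Implicit Types v : 'I_t -> mx_module A 1.

(** The block row of the Krylov matrices of the [v i], where block [i] has as
    many columns as the degree of [f i]. *)
Definition krylov_row v : 'M[R]_(n.+1, \sum_(i < t) (size (f i)).-1) :=
  \mxrow_(i < t) krylov A (v i) (size (f i)).-1.

Lemma mul_krylov_row v (y : 'cV[R]_(\sum_(i < t) (size (f i)).-1)) :
  krylov_row v *m y =
  (\sum_(i < t) rVpoly (submxcol y i)^T *: v i : mx_module A 1).
Proof.
rewrite -{1}[y]submxcolK mul_mxrow_mxcol.
by apply: eq_bigr => i _; rewrite mul_krylov.
Qed.

Lemma size_rVpoly_lt i (y : 'cV[R]_((size (f i)).-1)) :
  (size (rVpoly y^T) < size (f i))%N.
Proof.
apply: leq_ltn_trans (size_poly _ _) _.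
by rewrite prednK // size_poly_gt0 monic_neq0.
Qed.

(** The coefficients of the remainders of the [p i] modulo the [f i], block by
    block. *)
Definition rem_col (p : 'I_t -> {poly R}) :
    'cV[R]_(\sum_(i < t) (size (f i)).-1) :=
  \mxcol_(i < t) (poly_rV (Pdiv.Ring.rmodp (p i) (f i)))^T.

Lemma rVpoly_rem_col p i :
  rVpoly (submxcol (rem_col p) i)^T = Pdiv.Ring.rmodp (p i) (f i).
Proof.
rewrite mxcolK trmxK poly_rV_K //.
rewrite -ltnS prednK ?size_poly_gt0 ?monic_neq0 //.
by rewrite Pdiv.Ring.ltn_rmodpN0 // monic_neq0.
Qed.

Lemma mul_krylov_rem_col v p : (forall i, f i *: v i = 0) ->
  krylov_row v *m rem_col p = (\sum_(i < t) p i *: v i : mx_module A 1).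
Proof.
move=> fv; rewrite mul_krylov_row; apply: eq_bigr => i _.
rewrite rVpoly_rem_col [in RHS](Pdiv.RingMonic.rdivp_eq (f_mon i) (p i)).
by rewrite scalerDl -scalerA fv scaler0 add0r.
Qed.

(** The block row is injective since a remainder divisible by [f i] is zero, and
    surjective since the [v i] span and each coefficient can be replaced by its
    remainder modulo [f i]. *)
Lemma cyclic_decomposition_krylov_inv v :
  cyclic_decomposition f v ->
  exists Q',
    krylov_row v *m Q' = 1%:M /\ Q' *m krylov_row v = 1%:M.
Proof.
move=> dec_v; have ann := cyclic_decomposition_ann dec_v.
have [span rel] := dec_v.
have fv i : f i *: v i = 0 by apply/ann; exact: dividesxx.
have inj (y : 'cV_(\sum_(i < t) (size (f i)).-1)) :
    krylov_row v *m y = 0 -> y = 0.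
  rewrite mul_krylov_row => /rel y0; apply/mxcolP => i.
  have /(canRL rVpolyK) : rVpoly (submxcol y i)^T = 0.
    exact: divides_size_lt (f_mon i) (size_rVpoly_lt _) (y0 i).
  rewrite !linear0 => /(canRL trmxK) ->.
  by apply/matrixP => a b; rewrite !mxE.
have /fin_all_exists[w wE] (j : 'I_n.+1) :
    exists y : 'cV_(\sum_(i < t) (size (f i)).-1),
      krylov_row v *m y = delta_mx j 0 :> 'cV_n.+1.
  have [p ->] := span (delta_mx j 0 : 'cV_n.+1).
  by exists (rem_col p); exact: mul_krylov_rem_col.
pose Q' := \matrix_(i, j) w j i 0.
have QQ' : krylov_row v *m Q' = 1%:M.
  apply/matrixP => i j.
  have colQ' : col j Q' = w j by apply/colP => l; rewrite !mxE.
  have := wE j; rewrite -colQ' colE mulmxA -colE => /colP/(_ i).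
  by rewrite mxE => ->; rewrite !mxE eqxx andbT.
exists Q'; split=> //; apply/eqP; rewrite -subr_eq0; apply/eqP.
set D := (X in X = 0); apply/matrixP => i j.
have /inj/colP/(_ i) : krylov_row v *m col j D = 0; last by rewrite !mxE.
by rewrite colE mulmxA mulmxBr mulmxA QQ' mul1mx mulmx1 subrr mul0mx.
Qed.

(** If [\sum_i p i *: v i = 0], the block row sends the remainders of the [p i]
    to 0, so they vanish, which is divisibility by the [f i]. *)
Lemma krylov_inv_cyclic_decomposition v Q' :
  (forall i, f i *: v i = 0) ->
  krylov_row v *m Q' = 1%:M -> Q' *m krylov_row v = 1%:M ->
  cyclic_decomposition f v.
Proof.
move=> fv QQ' Q'Q; split=> [x|p].
  exists (fun i => rVpoly (submxcol (Q' *m (x : 'cV_n.+1)) i)^T).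
  by rewrite -mul_krylov_row mulmxA QQ' mul1mx.
split=> [pv0 i|hp]; last first.
  by apply: big1 => i _; have [q ->] := hp i; rewrite -scalerA fv scaler0.
have r0 : rem_col p = 0.
  rewrite -[LHS]mul1mx -Q'Q -mulmxA mul_krylov_rem_col // pv0.
  exact: (mulmx0 _ Q').
exists (Pdiv.Ring.rdivp (p i) (f i)).
rewrite [LHS](Pdiv.RingMonic.rdivp_eq (f_mon i) (p i)) -rVpoly_rem_col r0.
rewrite (_ : submxcol 0 i = 0) ?trmx0 ?linear0 ?addr0 //.
by apply/matrixP => a b; rewrite !mxE.
Qed.

End KrylovRow.

Lemma mx_has_invariant_factorsP (R : idomainType) (n : nat) (A : 'M[R]_n.+1)
    (fs : seq {poly R}) :
  mx_has_invariant_factors A fs <->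
  monic_chain fs /\
  exists v : 'I_(size fs) -> mx_module A 1,
    cyclic_decomposition (fun i : 'I_(size fs) => fs`_i) v.
Proof.
split=> [[fs_chain [e /is_similar_castP[Q [Q' [QQ' Q'Q AQ]]]]]|].
  split=> //; have f_mon (i : 'I_(size fs)) : fs`_i \is monic.
    by case: fs_chain => + _; apply.
  have AB i : A *m submxrow Q i = submxrow Q i *m companion fs`_i.
    move: i; apply/eq_mxrowP.
    by rewrite -mul_mxrow -mul_mxrow_mxdiag submxrowK.
  have /fin_all_exists2[v fv BE] i :=
    krylov_of_companion (f_mon i) (AB i).
  exists v; apply: (krylov_inv_cyclic_decomposition f_mon (Q' := Q')) => //.
    by rewrite -QQ' -[in RHS](submxrowK Q); congr (_ *m _); apply/eq_mxrowP.
  by rewrite -Q'Q -[in RHS](submxrowK Q); congr (_ *m _); apply/eq_mxrowP.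
move=> [fs_chain [v dec_v]]; split=> //.
have f_mon (i : 'I_(size fs)) : fs`_i \is monic.
  by case: fs_chain => + _; apply.
have [Q' [QQ' Q'Q]] := cyclic_decomposition_krylov_inv f_mon dec_v.
have e : (\sum_(i < size fs) (size (fs`_i)%R).-1)%N = n.+1.
  by apply/eqP; rewrite eqn_leq (mulmx1_min QQ') (mulmx1_min Q'Q).
exists e; apply/is_similar_castP;
  exists (krylov_row (fun i : 'I_(size fs) => fs`_i) v), Q'.
split=> //; rewrite mul_mxrow mul_mxrow_mxdiag; apply: eq_mxrow => i.
apply: (proj1 (mul_krylov_companion A (v i) (f_mon i))).
by apply/(cyclic_decomposition_ann dec_v); exact: dividesxx.
Qed.

Unset Implicit Arguments.

Theorem theorem9p3 (R : idomainType) (n : nat) (A : 'M[R]_n.+1)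
    (fs : seq {poly R}) (f1_neq1 : fs`_0 != 1) :
  (mx_has_invariant_factors A fs <->
     module_has_invariant_factors (mx_module A 1) fs) /\
  (mx_has_invariant_factors A fs ->
     module_has_invariant_factors (mx_module A n.+1)
       (flatten [seq nseq n.+1 f | f <- fs])).
Proof.
split.
  apply: (iff_trans (mx_has_invariant_factorsP _ _)).
  by split=> -[fs_chain /direct_sum_cyclicP dec]; split.
move=> /mx_has_invariant_factorsP[fs_chain [v dec_v]].
split; first exact: monic_chain_flatten_nseq.
apply/direct_sum_cyclicP.
exact: cyclic_decomposition_nseq dec_v.
Qed.
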